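(* Let $\bar z\in\mathbb R^n$ be a feasible point of (P). Consider the following two assumptions: (a) $\mathcal H_M$ is metrically subregular at $((\bar z,\lambda),(0,0,0))$ for each $\lambda\in K(\bar z)$, and $\widehat K$ is inner semicompact at $(\bar z,0)$ w.r.t. $\operatorname{dom}\widehat K$; (b) $\mathcal H_M$ is metrically subregular at $((\bar z,\bar\lambda),(0,0,0))$ for some $\bar\lambda\in K(\bar z)$, and $\widehat K$ is inner semicontinuous at $((\bar z,0),\bar\lambda)$ w.r.t. $\operatorname{dom}\widehat K$. Then each of the conditions (a) and (b) implies that $H_M$ is metrically subregular at $(\bar z,(0,0))$.
   Context: Let $f\colon\mathbb R^n\to\mathbb R$ be locally Lipschitz continuous, let $F\colon\mathbb R^n\rightrightarrows\mathbb R^m$ and $G\colon\mathbb R^n\times\mathbb R^m\rightrightarrows\mathbb R^s$ be set-valued mappings with closed graphs, and let $M\subset\mathbb R^n$ be nonempty and closed. Set $H(z):=\bigcup_{\lambda\in F(z)}G(z,\lambda)$; it is assumed that $\operatorname{gph}H$ is (locally) closed. Problem (P): minimize $f(z)$ over $z\in\mathbb R^n$ subject to $0\in H(z)$, $z\in M$. Put $K(z):=\{\lambda\in F(z)\mid 0\in G(z,\lambda)\}$ and $\widehat K(z,w):=\{\lambda\in F(z)\mid w\in G(z,\lambda)\}$ for $z\in\mathbb R^n$, $w\in\mathbb R^s$. Auxiliary mappings: $H_M(z):=H(z)\times(z-M)$ and $\mathcal H_M(z,\lambda):=(F(z)-\lambda)\times G(z,\lambda)\times(z-M)$. Products carry the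 sum of Euclidean norms; $\operatorname{dist}(z,A)=\inf_{a\in A}\|a-z\|$ ($=+\infty$ if $A=\varnothing$). For a set-valued mapping $\Upsilon$, $\operatorname{dom}\Upsilon=\{z\mid\Upsilon(z)\neq\varnothing\}$ and $\Upsilon^{-1}(w)=\{z\mid w\in\Upsilon(z)\}$. $\Upsilon$ is metrically subregular at $(\bar z,\bar w)\in\operatorname{gph}\Upsilon$ if there are $\kappa>0$ and a neighborhood $U$ of $\bar z$ with $\operatorname{dist}(z,\Upsilon^{-1}(\bar w))\le\kappa\operatorname{dist}(\bar w,\Upsilon(z))$ for all $z\in U$. $\Upsilon$ is inner semicompact at $\bar z\in\operatorname{dom}\Upsilon$ w.r.t. a set $\Omega$ if for each sequence $\{z_k\}\subset\Omega$ with $z_k\to\bar z$ there are a subsequence $\{z_{k_l}\}$ and a convergent sequence $\{w_l\}$ with $w_l\in\Upsilon(z_{k_l})$ for all $l$. $\Upsilon$ is inner semicontinuous at $(\bar z,\bar w)\in\operatorname{gph}\Upsilon$ w.r.t. $\Omega$ if for each sequence $\{z_k\}\subset\Omega$ with $z_k\to\bar z$ there is a sequence $w_k\to\bar w$ with $w_k\in\Upsilon(z_k)$ for all sufficiently large $k$. *)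

(* Defs.v *)
From HB Require Import structures.
From mathcomp Require Import all_boot all_order all_algebra.
From mathcomp Require Import all_classical all_reals all_analysis.

Set Implicit Arguments.
Unset Strict Implicit.
Unset Printing Implicit Defensive.

Import Order.TTheory GRing.Theory Num.Theory.
Import numFieldNormedType.Exports.

Local Open Scope classical_set_scope.
Local Open Scope ring_scope.

(* The canonical norms of MathComp-Analysis on 'rV[R]_n and on products are
   maximum norms. Distances below are therefore computed with the following
   explicit norms; closedness, neighborhoods and limits use the library
   topology, which is the one induced by any of these equivalent norms. *)
Definition enorm (R : realType) (n : nat) (x : 'rV[R]_n) : R :=
  Num.sqrt (\sum_(i < n) x 0 i ^+ 2).

Definition sumnorm (R : realType) (X Y : Type) (nX : X -> R) (nY : Y -> R)
    (p : X * Y) : R := nX p.1 + nY p.2.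

(* The infimum of the empty set is +oo. *)
Definition dist (R : realType) (X : zmodType) (nX : X -> R) (z : X)
    (A : set X) : \bar R :=
  ereal_inf [set (nX (a - z))%:E | a in A].

Definition locally_lipschitz (R : realType) (n : nat) (f : 'rV[R]_n -> R) :=
  forall x : 'rV[R]_n, exists (L : R) (U : set 'rV[R]_n), nbhs x U /\
    forall y y', U y -> U y' -> `|f y - f y'| <= L * enorm (y - y').

Definition locally_closed (T : topologicalType) (A : set T) :=
  forall x, A x -> exists V, [/\ nbhs x V, closed V & closed (A `&` V)].

Definition gph (X Y : Type) (Ups : X -> set Y) : set (X * Y) :=
  [set p | Ups p.1 p.2].

Definition dom (X Y : Type) (Ups : X -> set Y) : set X :=
  [set z | Ups z !=set0].

Definition invmap (X Y : Type) (Ups : X -> set Y) (w : Y) : set X :=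
  [set z | Ups z w].

Definition metrically_subregular (R : realType) (X Y : normedModType R)
    (nX : X -> R) (nY : Y -> R) (Ups : X -> set Y) (zbar : X) (wbar : Y) :=
  gph Ups (zbar, wbar) /\
  exists kappa : R, 0 < kappa /\
    exists U : set X, nbhs zbar U /\
      forall z, U z ->
        (dist nX z (invmap Ups wbar) <= kappa%:E * dist nY wbar (Ups z))%E.

Definition inner_semicompact (X : topologicalType) (Y : ptopologicalType)
    (Ups : X -> set Y) (zbar : X) (Omega : set X) :=
  dom Ups zbar /\
  forall z : nat -> X, (forall k, Omega (z k)) -> z @ \oo --> zbar ->
    exists (phi : nat -> nat) (w : nat -> Y),
      [/\ {homo phi : i j / (i < j)%N}, cvgn w &
          forall l, Ups (z (phi l)) (w l)].

Definition inner_semicontinuous (X Y : topologicalType) (Ups : X -> set Y)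
    (zbar : X) (wbar : Y) (Omega : set X) :=
  gph Ups (zbar, wbar) /\
  forall z : nat -> X, (forall k, Omega (z k)) -> z @ \oo --> zbar ->
    exists w : nat -> Y,
      w @ \oo --> wbar /\ \forall k \near \oo, Ups (z k) (w k).

Section ImplicitVariables.
Variables (R : realType) (n m s : nat).
Variables (F : 'rV[R]_n -> set 'rV[R]_m).
Variables (G : 'rV[R]_n * 'rV[R]_m -> set 'rV[R]_s).
Variable M : set 'rV[R]_n.

Definition Hmap (z : 'rV[R]_n) : set 'rV[R]_s :=
  \bigcup_(lambda in F z) G (z, lambda).

Definition feasible (z : 'rV[R]_n) := Hmap z 0 /\ M z.

Definition Kmap (z : 'rV[R]_n) : set 'rV[R]_m :=
  [set lambda | F z lambda /\ G (z, lambda) 0].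

Definition Khat (zw : 'rV[R]_n * 'rV[R]_s) : set 'rV[R]_m :=
  [set lambda | F zw.1 lambda /\ G (zw.1, lambda) zw.2].

Definition HM (z : 'rV[R]_n) : set ('rV[R]_s * 'rV[R]_n) :=
  Hmap z `*` [set z - x | x in M].

(* The triple product is nested to the left, as in (a, b, c) = ((a, b), c). *)
Definition calHM (zl : 'rV[R]_n * 'rV[R]_m) :
    set ('rV[R]_m * 'rV[R]_s * 'rV[R]_n) :=
  [set mu - zl.2 | mu in F zl.1] `*` G zl `*` [set zl.1 - x | x in M].

Definition HM_subregular (z : 'rV[R]_n) :=
  metrically_subregular (@enorm R n) (sumnorm (@enorm R s) (@enorm R n))
    HM z (0, 0).

Definition calHM_subregular (z : 'rV[R]_n) (lambda : 'rV[R]_m) :=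
  metrically_subregular (sumnorm (@enorm R n) (@enorm R m))
    (sumnorm (sumnorm (@enorm R m) (@enorm R s)) (@enorm R n))
    calHM (z, lambda) (0, 0, 0).

End ImplicitVariables.

(* Main.v *)
(** If [HM] fails to be subregular at [zbar], there are [z k --> zbar],
    [w k \in H (z k)] and [x k \in M] such that [k * (|w k| + |z k - x k|)] is
    smaller than the distance from [z k] to the feasible set. That distance is
    at most [|zbar - z k|], so [w k --> 0] and [Khat] provides multipliers
    [l k] accumulating at some [lambda]. Subregularity of [calHM] at
    [(zbar, lambda)] bounds the distance from [(z k, l k)] to the lifted
    feasible set by [kappa * (|w k| + |z k - x k|)], as [l k \in F (z k)] kills
    the first component of the residual. The lifted feasible set projects into
    the feasible set, which gives a contradiction once [k >= kappa]. *)
Require Import Defs.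
From HB Require Import structures.
From mathcomp Require Import all_boot all_order all_algebra.
From mathcomp Require Import all_classical all_reals all_analysis.

Set Implicit Arguments.
Unset Strict Implicit.
Unset Printing Implicit Defensive.

Import Order.TTheory GRing.Theory Num.Theory.
Import numFieldNormedType.Exports.

Local Open Scope classical_set_scope.
Local Open Scope ring_scope.

Lemma enorm_ge0 (R : realType) (n : nat) (x : 'rV[R]_n) : 0 <= enorm x.
Proof. exact: sqrtr_ge0. Qed.

Lemma enorm0 (R : realType) (n : nat) : enorm (0 : 'rV[R]_n) = 0.
Proof. by rewrite /enorm big1 ?sqrtr0// => i _; rewrite mxE expr0n. Qed.

Lemma enormN (R : realType) (n : nat) (x : 'rV[R]_n) : enorm (- x) = enorm x.
Proof. by congr Num.sqrt; apply: eq_bigr => i _; rewrite mxE sqrrN. Qed.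

(** Turns bounds in [enorm] into convergence for the library topology, which comes from the maximum
    norm. *)
Lemma norm_le_enorm (R : realType) (n : nat) (x : 'rV[R]_n) :
  `|x| <= enorm x.
Proof.
rewrite [`|x|]mx_normrE; apply: bigmax_le => [|[i j] _ /=].
  exact: enorm_ge0.
rewrite ord1 -sqrtr_sqr ler_sqrt; last first.
  by apply: sumr_ge0 => k _; exact: sqr_ge0.
by rewrite (bigD1 j)//= lerDl sumr_ge0// => k _; exact: sqr_ge0.
Qed.

Lemma continuous_enorm (R : realType) (n : nat) : continuous (@enorm R n).
Proof.
move=> x; apply: (@continuous_comp _ _ _
  (fun x : 'rV[R]_n => \sum_(i < n) x 0 i ^+ 2)); last exact: sqrt_continuous.
apply: continuous_big => [|i _ {}x]; first exact: add_continuous.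
apply: (@continuous_comp _ _ _ (fun x : 'rV[R]_n => x 0 i) (fun y => y ^+ 2)).
  exact: coord_continuous.
exact: exprn_continuous.
Qed.

Lemma cvg_extraction (phi : nat -> nat) :
  {homo phi : i j / (i < j)%N} -> phi @ \oo --> \oo.
Proof.
move=> phi_incr A [N _ NA]; exists N => // k /= Nk; apply: NA => /=.
apply: leq_trans Nk _; elim: k => // k ih.
by apply: leq_ltn_trans ih _; exact: phi_incr.
Qed.

(* In [cvg_pair] the limit is a pair of filters, a form that is not inferred
   from a goal whose limit is a point. *)
Lemma cvg_pair_nbhs (T : Type) (X Y : topologicalType) (A : set_system T)
    {FA : Filter A} (f : T -> X) (g : T -> Y) (a : X) (b : Y) :
  f @ A --> a -> g @ A --> b -> (f t, g t) @[t --> A] --> (a, b).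
Proof. exact: (@cvg_pair _ _ _ _ (nbhs a) (nbhs b)). Qed.

Lemma dist_le (R : realType) (X : zmodType) (nX : X -> R) (z a : X)
    (A : set X) : A a -> (dist nX z A <= (nX (a - z)%R)%:E)%E.
Proof. by move=> Aa; apply: ereal_inf_lbound; exists a. Qed.

Lemma le_dist (R : realType) (X : zmodType) (nX : X -> R) (z : X)
    (A : set X) (d : \bar R) :
  (forall a, A a -> (d <= (nX (a - z)%R)%:E)%E) -> (d <= dist nX z A)%E.
Proof. by move=> h; apply: le_ereal_inf_tmp => _ [a Aa <-]; exact: h. Qed.

Section Subregularity.
Variables (R : realType) (n m s : nat).
Variables (F : 'rV[R]_n -> set 'rV[R]_m).
Variables (G : 'rV[R]_n * 'rV[R]_m -> set 'rV[R]_s).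
Variable M : set 'rV[R]_n.

Lemma invmap_HM (z : 'rV[R]_n) :
  invmap (HM F G M) (0, 0) z <-> feasible F G M z.
Proof.
split=> [[/= Hz [x Mx zx]]|[Hz Mz]].
  by split=> //; rewrite -(subr0 z) -zx subKr.
by split=> //=; exists z => //; rewrite subrr.
Qed.

(** The projection sending [(y, mu)] to [y] carries zeros of [calHM] to feasible points and does not
    increase distances, the norm on pairs being a sum. On the right, the infimum is estimated by the
    residual [(0, w, z - x)], available since [l] lies in [F z]. *)
Lemma dist_feasible_le (z x : 'rV[R]_n) (l : 'rV[R]_m) (w : 'rV[R]_s)
    (kappa : R) :
  0 <= kappa -> F z l -> G (z, l) w -> M x ->
  (dist (sumnorm (@enorm R n) (@enorm R m)) (z, l)
     (invmap (calHM F G M) (0, 0, 0)%R) <=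
   kappa%:E * dist (sumnorm (sumnorm (@enorm R m) (@enorm R s)) (@enorm R n))
     (0, 0, 0)%R (calHM F G M (z, l)))%E ->
  (dist (@enorm R n) z (invmap (HM F G M) (0, 0)%R) <=
   (kappa * (enorm w + enorm (z - x)))%R%:E)%E.
Proof.
move=> kappa0 Fzl Gzlw Mx; set d := dist _ _ _ => sub.
have dle : (dist (@enorm R n) z (invmap (HM F G M) (0, 0)%R) <= d)%E.
  apply: le_dist => -[y mu] [[[/= nu Fnu numu] Gy] [x' Mx' yx']].
  apply: (@le_trans _ _ (enorm (y - z)%R)%:E).
    apply/dist_le/invmap_HM; split.
      exists nu => //; suff -> : nu = mu by [].
      by apply/eqP; rewrite -subr_eq0 numu.
    by rewrite -(subr0 y) -yx' subKr.
  by rewrite lee_fin /sumnorm/= lerDl enorm_ge0.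
apply: (le_trans dle); apply: (le_trans sub).
rewrite EFinM lee_wpmul2l ?lee_fin//.
have -> : enorm w + enorm (z - x) =
    sumnorm (sumnorm (@enorm R m) (@enorm R s)) (@enorm R n)
      ((0, w, z - x) - (0, 0, 0)).
  by rewrite /sumnorm/= !subr0 enorm0 add0r.
apply: dist_le; split; last by exists x.
by split=> //=; exists l => //; rewrite subrr.
Qed.

(** A strict upper bound on an infimum is witnessed by a single element; if [HM F G M z] is empty,
    the distance is [+oo] and the hypothesis fails. *)
Lemma small_residual_HM (z : 'rV[R]_n) (c : R) (d : \bar R) :
  0 < c ->
  (c%:E * dist (sumnorm (@enorm R s) (@enorm R n)) (0, 0)%R
     (HM F G M z) < d)%E ->
  exists w x, [/\ Hmap F G z w, M x &
    ((c * (enorm w + enorm (z - x)))%R%:E < d)%E].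
Proof.
move=> c0; rewrite ltNge => /negP; apply: contra_notP => none.
rewrite -lee_pdivrMl//; apply: le_dist => -[w _] [/= Hw [x Mx <-]].
rewrite lee_pdivrMl// leNgt; apply/negP => lt; apply: none; exists w, x.
by split=> //; move: lt; rewrite /sumnorm/= !subr0 -EFinM.
Qed.

Lemma cvg_pair_harmonic (z : nat -> 'rV[R]_n) (w : nat -> 'rV[R]_s)
    (zbar : 'rV[R]_n) :
  (forall k, `|zbar - z k| < k.+1%:R^-1) ->
  (forall k, enorm (w k) < k.+1%:R^-1) ->
  (fun k => (z k, w k)) @ \oo --> (zbar, 0 : 'rV[R]_s).
Proof.
move=> zk wk; apply: cvg_pair_nbhs.
  apply/cvgrPdist_lt => e e0; near=> k; apply: lt_trans (zk k) _; near: k.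
  exact: (near_infty_natSinv_lt (PosNum e0)).
apply/cvgrPdist_lt => e e0; near=> k; rewrite sub0r normrN.
apply: le_lt_trans (norm_le_enorm _) _.
apply: lt_trans (wk k) _; near: k.
exact: (near_infty_natSinv_lt (PosNum e0)).
Unshelve. all: by end_near. Qed.

(** The common core of both cases: [lambda] may depend on the sequence, to suit inner
    semicompactness, and membership in [Khat] is asked only eventually, to suit inner
    semicontinuity. *)
Lemma HM_subregular_of_multipliers (zbar : 'rV[R]_n) :
  feasible F G M zbar ->
  (forall zw : nat -> 'rV[R]_n * 'rV[R]_s,
    (forall k, dom (Khat F G) (zw k)) -> zw @ \oo --> (zbar, 0 : 'rV[R]_s) ->
    exists lambda phi (l : nat -> 'rV[R]_m),
      [/\ calHM_subregular F G M zbar lambda,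
          {homo phi : i j / (i < j)%N}, l @ \oo --> lambda &
          \forall k \near \oo, Khat F G (zw (phi k)) (l k)]) ->
  HM_subregular F G M zbar.
Proof.
move=> feas mult; have HM0 := (invmap_HM zbar).2 feas.
split=> //; apply: contrapT => nsub.
pose d z := dist (@enorm R n) z (invmap (HM F G M) (0, 0)).
(* The modulus [k.+1] fails on the points within [k.+1%:R^-1] of [zbar] in both norms: the maximum
   norm serves convergence, [enorm] the comparison with [dist]. *)
have /choice[zwx zwxP] (k : nat) : exists p : 'rV[R]_n * 'rV[R]_s * 'rV[R]_n,
    [/\ `|zbar - p.1.1| < k.+1%:R^-1, enorm (zbar - p.1.1) < k.+1%:R^-1,
        Hmap F G p.1.1 p.1.2, M p.2 &
        ((k.+1%:R * (enorm p.1.2 + enorm (p.1.1 - p.2)))%R%:E < d p.1.1)%E].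
  apply: contrapT => none; apply: nsub; exists k.+1%:R; split=> //.
  exists [set z | `|zbar - z| < k.+1%:R^-1 /\ enorm (zbar - z) < k.+1%:R^-1].
  have k0 : 0 < k.+1%:R^-1 :> R by rewrite invr_gt0.
  have near_norm : \forall z \near zbar, `|zbar - z| < k.+1%:R^-1.
    by move: (@cvg_id _ (nbhs zbar)) => /cvgrPdist_lt/(_ _ k0).
  have near_enorm : \forall z \near zbar, enorm (zbar - z) < k.+1%:R^-1.
    have : (fun z => enorm (zbar - z)) @ zbar --> (0 : R).
      rewrite -[X in _ --> X](enorm0 R n) -(subrr zbar).
      have cvgz : zbar - z @[z --> zbar] --> zbar - zbar.
        by apply: (cvgB (cvg_cst _) cvg_id).
      exact: cvg_comp cvgz (@continuous_enorm R n (zbar - zbar)).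
    move/cvgrPdist_lt/(_ _ k0); apply: filterS => z /=.
    by rewrite sub0r normrN ger0_norm ?enorm_ge0.
  split; first exact: filterI near_norm near_enorm.
  move=> z [zk ezk]; rewrite leNgt; apply/negP.
  move=> /small_residual_HM[//|w [x [Hw Mx lt]]].
  by apply: none; exists (z, w, x).
pose z k := (zwx k).1.1; pose w k := (zwx k).1.2; pose x k := (zwx k).2.
have wk k : enorm (w k) < k.+1%:R^-1.
  have [_ ez _ _ lt] := zwxP k.
  (* As [zbar] is feasible, [d (z k)] is at most [enorm (zbar - z k)]; the factor [k.+1], being at
     least 1, can then be dropped. *)
  have := lt_le_trans lt (dist_le (@enorm R n) (z k) HM0).
  rewrite lte_fin => lt1; apply: le_lt_trans ez; apply: ltW.
  apply: le_lt_trans lt1; rewrite -/(w k).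
  apply: (@le_trans _ _ (enorm (w k) + enorm (z k - x k))).
    by rewrite lerDl enorm_ge0.
  by rewrite ler_peMl ?addr_ge0 ?enorm_ge0// ler1n.
have zk k : `|zbar - z k| < k.+1%:R^-1 by case: (zwxP k).
have cvgzw := cvg_pair_harmonic zk wk.
have domzw k : dom (Khat F G) (z k, w k).
  by have [_ _ [l Fl Gl] _ _] := zwxP k; exists l.
have [lambda [phi [l [[_ [kappa [kappa0 [U [Unbhs sub]]]]]]]]] :=
  mult _ domzw cvgzw.
move=> /cvg_extraction phioo cvgl nearK.
have cvgz : z @ \oo --> zbar.
  apply: (cvg_comp (fun k => (z k, w k)) fst cvgzw).
  exact: (@cvg_fst _ _ (nbhs zbar) (nbhs (0 : 'rV[R]_s))).
have cvgzl : (fun k => (z (phi k), l k)) @ \oo --> (zbar, lambda).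
  by apply: cvg_pair_nbhs => //; exact: (cvg_comp phi z phioo cvgz).
(* The modulus that fails at [z (phi k)] is [(phi k).+1], which eventually reaches the fixed
   [kappa]. *)
have kappa_phi : \forall k \near \oo, kappa <= (phi k).+1%:R.
  apply: (phioo [set k | kappa <= k.+1%:R]).
  apply: filterS (nbhs_infty_ger kappa) => k /le_trans; apply.
  by rewrite ler_nat.
have nearU : \forall k \near \oo, U (z (phi k), l k) by exact: cvgzl.
have [k [Uk [[Fk Gk] kappak]]] :=
  filter_ex (filterI nearU (filterI nearK kappa_phi)).
have [_ _ _ Mx lt] := zwxP (phi k).
(* At this single index, the distance from [z (phi k)] to the feasible set is above [(phi k).+1]
   times the residual and at most [kappa] times it. *)
have := lt_le_trans lt (dist_feasible_le (ltW kappa0) Fk Gk Mx (sub _ Uk)).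
rewrite lte_fin ltNge => /negP; apply.
by rewrite ler_wpM2r// addr_ge0 ?enorm_ge0.
Qed.

End Subregularity.

Theorem proposition4p13 (R : realType) (n m s : nat)
    (f : 'rV[R]_n -> R)
    (F : 'rV[R]_n -> set 'rV[R]_m)
    (G : 'rV[R]_n * 'rV[R]_m -> set 'rV[R]_s)
    (M : set 'rV[R]_n)
    (f_lip : locally_lipschitz f)
    (F_closed : closed (gph F))
    (G_closed : closed (gph G))
    (M_nonempty : M !=set0)
    (M_closed : closed M)
    (H_closed : locally_closed (gph (Hmap F G)))
    (zbar : 'rV[R]_n)
    (zbar_feasible : feasible F G M zbar) :
  ((forall lambda, Kmap F G zbar lambda -> calHM_subregular F G M zbar lambda) /\
     inner_semicompact (Khat F G) (zbar, 0) (dom (Khat F G)) ->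
   HM_subregular F G M zbar) /\
  ((exists lambdabar, [/\ Kmap F G zbar lambdabar,
       calHM_subregular F G M zbar lambdabar &
       inner_semicontinuous (Khat F G) (zbar, 0) lambdabar (dom (Khat F G))]) ->
   HM_subregular F G M zbar).
Proof.
split=> [[calsub [_ semicompact]]|[lambda [Kl calsub [_ semicont]]]];
  apply: HM_subregular_of_multipliers => // zw domzw cvgzw; last first.
  (* Inner semicontinuity serves the whole sequence, so the extraction is [id] and the limit is the
     given [lambda]. *)
  have [l [cvgl nearK]] := semicont zw domzw cvgzw.
  by exists lambda, id, l; split.
have [phi [l [phi_incr cvgl KhatP]]] := semicompact zw domzw cvgzw.
exists (lim (l @ \oo)), phi, l; split=> //; last exact: nearW.
(* It remains to see that the limit lies in [Kmap F G zbar]; the closed graphs of [F] and [G] give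
   this. *)
apply: calsub.
have cvgzwphi : zw (phi k) @[k --> \oo] --> (zbar, 0 : 'rV[R]_s).
  exact: (cvg_comp phi zw (cvg_extraction phi_incr) cvgzw).
have cvgz : (zw (phi k)).1 @[k --> \oo] --> zbar.
  apply: (cvg_comp (zw \o phi) fst cvgzwphi).
  exact: (@cvg_fst _ _ (nbhs zbar) (nbhs (0 : 'rV[R]_s))).
have cvgw : (zw (phi k)).2 @[k --> \oo] --> (0 : 'rV[R]_s).
  apply: (cvg_comp (zw \o phi) snd cvgzwphi).
  exact: (@cvg_snd _ _ (nbhs zbar) (nbhs (0 : 'rV[R]_s))).
have cvgzl : ((zw (phi k)).1, l k) @[k --> \oo] --> (zbar, lim (l @ \oo)).
  exact: cvg_pair_nbhs cvgz cvgl.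
have Flim : gph F (zbar, lim (l @ \oo)).
  apply: (closed_cvg (gph F) F_closed _ _ cvgzl).
  by apply: nearW => k; case: (KhatP k).
have Glim : gph G (zbar, lim (l @ \oo), 0).
  apply: (closed_cvg (gph G) G_closed _ _ (cvg_pair_nbhs cvgzl cvgw)).
  by apply: nearW => k; case: (KhatP k).
by split.
Qed.
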